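(* Let $G$ be an abelian group with a direct sum decomposition $G=\mathbb Z\oplus H$, where $\mathbb Z$ denotes an infinite cyclic subgroup and $H<G$ is a finite subgroup. Let $A\subseteq G$ be a finite set, let $n$ be the number of elements of the image of $A$ under the projection $G\to\mathbb Z$ along $H$, and let $\tau:=|2A|/|A|$. If $|2A|<3\big(1-\frac1n\big)|A|$, then there exist an arithmetic progression $P\subseteq G$ with $3\le|P|\le(\tau-1)n+1$ and a subgroup $K\le H$ such that $|P+K|=|P||K|$, $A\subseteq P+K$, and $(|P|-1)|K|\le|2A|-|A|$.
   Context: For subsets $X,Y$ of an abelian group, $X+Y=\{x+y\colon x\in X,\ y\in Y\}$ and $2X=X+X$. An arithmetic progression in $G$ is a set $\{c+jd\colon j=0,1,\dots,N\}$ with $c,d\in G$, $N\ge0$ an integer; $|P|$ is its number of elements. *)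

(* Defs.v *)
From mathcomp Require Import all_boot all_order all_algebra finmap.

Set Implicit Arguments.
Unset Strict Implicit.
Unset Printing Implicit Defensive.

Import GRing.Theory.
Local Open Scope fset_scope.
Local Open Scope ring_scope.

Definition sumset (G : zmodType) (X Y : {fset G}) : {fset G} :=
  [fset x + y | x in X, y in Y].

Definition arith_prog (G : zmodType) (P : {fset G}) : Prop :=
  exists (c d : G) (N : nat), P = [fset c + d *+ val j | j in 'I_N.+1].

Definition infinite_cyclic (G : zmodType) (Z : {pred G}) : Prop :=
  exists z : G, injective (fun m : int => z *~ m) /\
    forall x : G, x \in Z <-> exists m : int, x = z *~ m.

Definition direct_sum (G : zmodType) (Z H : {pred G}) : Prop :=
  (forall x : G, exists z h : G, [/\ z \in Z, h \in H & x = z + h]) /\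
  (forall x : G, x \in Z -> x \in H -> x = 0).

(* When G is the direct sum of Z and H, this determines p uniquely. *)
Definition projection_along (G : zmodType) (Z H : {pred G}) (p : G -> G) :
    Prop :=
  forall x : G, p x \in Z /\ x - p x \in H.

(* Main.v *)
Require Import Defs.
From HB Require Import structures.
From mathcomp Require Import all_boot all_order all_algebra finmap.
From mathcomp Require Import zify ring lra ring_quotient generic_quotient.

(* Let [psi : G -> Z] be the projection, normalised so that [A] has minimum
   height 0, attained at [0 \in A], and maximum height attained at [g \in A].
   Following Lev and Smeliansky, wrap [A] modulo [g], i.e. pass to its image
   [A'] in [G / <g>]: every element [x] of [A] yields two elements [x] and
   [x + g] of [2A] with the same image, so [|2A| >= |2A'| + |A|].  Kneser's
   theorem gives a finite period [K'] of [2A'] with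
   [|2A'| >= 2|A' + K'| - |K'|].
   If [A'] lies in [K'], then the preimage of [K'] is [<d> + K] with [K <= H],
   and the progression of difference [d] from [0] to [g] has length
   [|K'| / |K| + 1], where [|K'| <= |2A'| <= |2A| - |A|].
   Otherwise [A'] meets two cosets of [K'] and counting [2A] coset by coset
   gives [|2A| >= 3(1 - 1/n)|A|].  For this, [|A|] in the first estimate is
   replaced by [|E + A|], where [E] is the set of bottom elements [e] of [A]
   with [e + g \in A], and, if [A'] nearly fills its cosets, one coset of [K']
   contained in [2A'] but not in [A' + K'] is treated by Kneser's theorem in
   [G] itself. *)

Set Implicit Arguments.
Unset Strict Implicit.
Unset Printing Implicit Defensive.

Import Order.TTheory GRing.Theory Num.Theory.
Local Open Scope fset_scope.
Local Open Scope ring_scope.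

(** * Sumsets, subgroups and periods *)

Section FsetCard.
Variable T : choiceType.
Implicit Types A B C : {fset T}.

Lemma leq_cardfs_cover A B C : C `<=` A `|` B -> (#|` C| <= #|` A| + #|` B|)%N.
Proof. by move/fsubset_leq_card/leq_trans; apply; rewrite cardfsU leq_subr. Qed.

Lemma leq_cardfs_disjoint A B C :
  A `<=` C -> B `<=` C -> (forall x, x \in A -> x \notin B) ->
  (#|` A| + #|` B| <= #|` C|)%N.
Proof.
move=> AC BC dAB; rewrite -cardfsUI.
have -> : A `&` B = fset0.
  apply/fsetP=> x; rewrite in_fsetI in_fset0.
  by apply/andP=> -[/dAB /negP].
by rewrite cardfs0 addn0 fsubset_leq_card // fsubUset AC BC.
Qed.

Lemma leq_cardfs_in_inj (T' : choiceType) (f : T -> T') A (B : {fset T'}) :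
  {in A &, injective f} -> (forall x, x \in A -> f x \in B) ->
  (#|` A| <= #|` B|)%N.
Proof.
move=> injf fAB.
have <- : #|` [fset f x | x in A]| = #|` A| by apply: card_in_imfset.
by apply: fsubset_leq_card; apply/fsubsetP=> _ /imfsetP[x /= xA ->]; apply: fAB.
Qed.

End FsetCard.

Section Sumset.
Variable G : zmodType.
Implicit Types (A B C K X Y : {fset G}) (x y : G).

Definition coset x K : {fset G} := [fset x + k | k in K].

Lemma sumsetP A B z :
  reflect (exists x y, [/\ x \in A, y \in B & z = x + y]) (z \in sumset A B).
Proof.
apply: (iffP (imfset2P _ _ _ _ _)) => /=.
  by case=> x xA [y yB ->]; exists x, y.
by case=> x [y [xA yB ->]]; exists x => //; exists y.
Qed.

Lemma mem_sumset A B x y : x \in A -> y \in B -> x + y \in sumset A B.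
Proof. by move=> xA yB; apply/sumsetP; exists x, y. Qed.

Lemma sumsetC A B : sumset A B = sumset B A.
Proof.
by apply/fsetP=> z; apply/sumsetP/sumsetP=> -[x [y [? ? ->]]];
  exists y, x; rewrite addrC.
Qed.

Lemma sumsetA A B C : sumset A (sumset B C) = sumset (sumset A B) C.
Proof.
apply/fsetP=> z; apply/sumsetP/sumsetP.
  case=> x [_ [xA /sumsetP[y [w [yB wC ->]]] ->]].
  by exists (x + y), w; rewrite addrA mem_sumset.
case=> _ [w [/sumsetP[x [y [xA yB ->]]] wC ->]].
by exists x, (y + w); rewrite addrA mem_sumset.
Qed.

Lemma sumsetS A B X Y : A `<=` X -> B `<=` Y -> sumset A B `<=` sumset X Y.
Proof.
move=> /fsubsetP AX /fsubsetP BY.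
by apply/fsubsetP=> _ /sumsetP[x [y [/AX ? /BY ? ->]]]; apply: mem_sumset.
Qed.

Lemma sumset_neq0 A B : A != fset0 -> B != fset0 -> sumset A B != fset0.
Proof.
by move=> /fset0Pn[x xA] /fset0Pn[y yB]; apply/fset0Pn; exists (x + y); apply: mem_sumset.
Qed.

Lemma sumsetUl A B C : sumset (A `|` B) C = sumset A C `|` sumset B C.
Proof.
apply/fsetP=> z; rewrite in_fsetU; apply/sumsetP/orP.
  case=> x [y [/fsetUP[] ? ? ->]]; [left|right]; exact: mem_sumset.
case=> /sumsetP[x [y [? ? ->]]]; exists x, y; split=> //; rewrite in_fsetU.
  by apply/orP; left.
by apply/orP; right.
Qed.

Lemma mem_coset x K z : (z \in coset x K) = (z - x \in K).
Proof.
apply/imfsetP/idP=> [[k /= kK ->]|zK]; first by rewrite addrC addKr.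
by exists (z - x) => //; rewrite addrC subrK.
Qed.

Lemma card_coset x K : #|` coset x K| = #|` K|.
Proof. by rewrite card_imfset //; apply: addrI. Qed.

Lemma sumset_cosetr x A B : sumset A (coset x B) = coset x (sumset A B).
Proof.
apply/fsetP=> z; rewrite mem_coset; apply/sumsetP/sumsetP.
  case=> a [b [aA]]; rewrite mem_coset => bB ->.
  by exists a, (b - x); rewrite addrA.
case=> a [b [aA bB E]]; exists a, (b + x); rewrite mem_coset addrK; split=> //.
by rewrite addrA -E subrK.
Qed.

Lemma leq_card_sumsetl A B y : y \in B -> (#|` A| <= #|` sumset A B|)%N.
Proof.
move=> yB; rewrite -(card_coset y) fsubset_leq_card //; apply/fsubsetP=> z.
by rewrite mem_coset => zA; rewrite -(subrK y z) mem_sumset.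
Qed.

Lemma leq_card_sumsetr A B x : x \in A -> (#|` B| <= #|` sumset A B|)%N.
Proof. by rewrite sumsetC; apply: leq_card_sumsetl. Qed.

Definition subgroup K := zmod_closed (mem K).
Definition periodic K X := sumset X K `<=` X.

Section SubgroupTheory.
Variable K : {fset G}.
Hypothesis sK : subgroup K.

Lemma subgroup0 : 0 \in K. Proof. by case: sK. Qed.
Lemma subgroupB x y : x \in K -> y \in K -> x - y \in K.
Proof. by case: sK => _; apply. Qed.
Lemma subgroupN x : x \in K -> - x \in K.
Proof. by rewrite -(sub0r x); apply/subgroupB/subgroup0. Qed.
Lemma subgroupD x y : x \in K -> y \in K -> x + y \in K.
Proof. by move=> xK yK; rewrite -(opprK y) subgroupB ?subgroupN. Qed.
Lemma subgroup_opp x y : x - y \in K -> y - x \in K.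
Proof. by rewrite -(opprB y x) => /subgroupN; rewrite opprK. Qed.
Lemma subgroup_diff x y z : x - y \in K -> y - z \in K -> x - z \in K.
Proof. by move=> h1 h2; rewrite -(subrK y x) -addrA subgroupD. Qed.
Lemma subgroup_gt0 : (0 < #|` K|)%N.
Proof. by rewrite cardfs_gt0; apply/fset0Pn; exists 0; apply: subgroup0. Qed.

Lemma sub_sumset_subgroup X : X `<=` sumset X K.
Proof.
by apply/fsubsetP=> x xX; rewrite -(addr0 x) mem_sumset ?subgroup0.
Qed.

Lemma leq_card_sumset_subgroup X : (#|` X| <= #|` sumset X K|)%N.
Proof. exact/fsubset_leq_card/sub_sumset_subgroup. Qed.

Lemma periodicD X x k : periodic K X -> x \in X -> k \in K -> x + k \in X.
Proof. by move=> /fsubsetP pX xX kK; apply/pX/mem_sumset. Qed.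

Lemma periodic_eqmod X x y : periodic K X -> x \in X -> y - x \in K -> y \in X.
Proof. by move=> pX xX yx; rewrite -(subrK x y) addrC (periodicD pX). Qed.

Lemma periodic_coset_sub X x : periodic K X -> x \in X -> coset x K `<=` X.
Proof.
by move=> pX xX; apply/fsubsetP=> y; rewrite mem_coset; apply: periodic_eqmod.
Qed.

Lemma periodic_sumset X : periodic K (sumset X K).
Proof.
rewrite /periodic -sumsetA; apply: sumsetS => //.
by apply/fsubsetP=> _ /sumsetP[x [y [xK yK ->]]]; apply: subgroupD.
Qed.

Lemma periodicP X : periodic K X -> sumset X K = X.
Proof. by move=> pX; apply/eqP; rewrite eqEfsubset sub_sumset_subgroup andbT. Qed.

(** A [K]-periodic set is a disjoint union of cosets of [K], and two cosets would already be too
    many elements. *)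
Lemma periodic_card_lt2 X :
  periodic K X -> (#|` X| < 2 * #|` K|)%N -> (#|` X| <= #|` K|)%N.
Proof.
move=> pX ltX; case: (fset_0Vmem X) => [->|[x xX]]; first by rewrite cardfs0.
rewrite -(card_coset x K); have sX := periodic_coset_sub pX xX.
case: (boolP (X `<=` coset x K)) => [/fsubset_leq_card //|/fsubsetPn[y yX yx]].
suff: (#|` coset x K| + #|` coset y K| <= #|` X|)%N by rewrite !card_coset; lia.
apply: leq_cardfs_disjoint => //; first exact: periodic_coset_sub.
move=> z; rewrite !mem_coset => zx; apply: contra yx => zy; rewrite mem_coset.
exact: subgroup_diff (subgroup_opp zy) zx.
Qed.

End SubgroupTheory.

Lemma sumset_sub_periodic K X Y : periodic K Y -> X `<=` Y -> sumset X K `<=` Y.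
Proof. by move=> pY XY; apply: fsubset_trans pY; apply: sumsetS. Qed.

Lemma proper_subgroup_card K L : subgroup K -> subgroup L -> K `<=` L ->
  K != L -> (2 * #|` K| <= #|` L|)%N.
Proof.
move=> sK sL KL nKL; rewrite leqNgt; apply/negP=> lt.
have pL : periodic K L.
  apply/fsubsetP=> _ /sumsetP[x [y [xL yK ->]]].
  by apply: subgroupD => //; apply: (fsubsetP KL).
have := periodic_card_lt2 sK pL lt; rewrite leqNgt fproper_ltn_card //.
by rewrite fproperEneq nKL.
Qed.

(** An element stabilizing a nonempty [C] is a difference of elements of [C], so cutting down to
    differences keeps the stabilizer a finite set. Inclusion is enough, since a translate of [C] has
    the size of [C]. *)
Definition stab C := [fset x in sumset C [fset - y | y in C] | coset x C `<=` C].

Lemma mem_stab C x : C != fset0 -> (x \in stab C) = (coset x C `<=` C).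
Proof.
move=> /fset0Pn[y yC]; rewrite !inE /=; apply/andP/idP=> [[]//|xC]; split=> //.
apply/sumsetP; exists (x + y), (- y); rewrite addrK; split=> //.
  by apply: (fsubsetP xC); rewrite mem_coset addrC addKr.
by apply/imfsetP; exists y.
Qed.

Lemma stab_subgroup C : C != fset0 -> subgroup (stab C).
Proof.
move=> C0; split=> [|x y]; rewrite /= ?mem_stab //.
  by apply/fsubsetP=> z; rewrite mem_coset subr0.
move=> xC yC; have yE : coset y C = C.
  by apply/eqP; rewrite eqEfcard yC card_coset leqnn.
apply/fsubsetP=> z; rewrite mem_coset opprB addrA => zC.
have: z + y \in coset y C.
  by rewrite yE; apply: (fsubsetP xC); rewrite mem_coset.
by rewrite mem_coset addrK.
Qed.

Lemma stab_periodic C : C != fset0 -> periodic (stab C) C.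
Proof.
move=> C0; apply/fsubsetP=> _ /sumsetP[x [y [xC yS ->]]].
move: yS; rewrite mem_stab // => /fsubsetP; apply.
by rewrite mem_coset addrK.
Qed.

End Sumset.

(** * Kneser's theorem *)

Section Kneser.
Variable G : zmodType.
Implicit Types (A B C H K X Y : {fset G}) (x y : G).

(** Kneser's inequality for some period [S] rather than for the full stabilizer: an inductive appeal
    then has to deliver one witness only. *)
Definition kneser_bound A B := exists S,
  [/\ subgroup S, periodic S (sumset A B) &
      (#|` sumset A S| + #|` sumset B S| <= #|` sumset A B| + #|` S|)%N].

(* DeVos's notion of a convergent set, with a period [H] that need not be the
   full stabilizer of [C]. *)
Definition convergent A B C H :=
  [/\ subgroup H, periodic H C, C != fset0, C `<=` sumset A B &
      (#|` A `&` B| + #|` sumset (A `|` B) H| <= #|` C| + #|` H|)%N].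

(** * Shrinking the period of a convergent set *)

Section Step.
Variables A B C H : {fset G}.
Hypothesis IH : forall A' B', A' != fset0 -> B' != fset0 ->
  (#|` sumset A' B'| < #|` sumset A B|)%N -> kneser_bound A' B'.
Hypothesis convC : convergent A B C H.
Variables a b h : G.
Hypotheses (aA : a \in A) (bB : b \in B) (hH : h \in H).
Hypothesis abh : a + b + h \notin sumset A B.

Let sH : subgroup H. Proof. by case: convC. Qed.
Let pC : periodic H C. Proof. by case: convC. Qed.
Let CAB : C `<=` sumset A B. Proof. by case: convC. Qed.

Definition slice X x := [fset y in X | y - x \in H].

(** What makes [E] fit to be joined to [C]: it lies in the coset [a + b + H], which [C] misses, and
    its period [K] is properly smaller than [H]. *)
Definition in_missing_coset E K := [/\ subgroup K, periodic K E, K `<=` H,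
  (#|` K| < #|` H|)%N & E `<=` sumset A B] /\
  [/\ E `<=` coset (a + b) H, (forall z, z \in E -> z \notin C) & E != fset0].

(** If [C], a union of cosets of [H] inside [A + B], met [a + b + H], it would contain
    [a + b + h]. *)
Lemma missing_coset_disjoint z : z \in sumset A B -> z - (a + b) \in H -> z \notin C.
Proof.
move=> zAB zH; apply: contra abh => zC; apply: (fsubsetP CAB).
apply: (periodic_eqmod pC zC).
by rewrite addrAC (subgroupD sH) // (subgroup_opp sH).
Qed.

(** The sumset avoids the nonempty [C], so it is smaller than [A + B] and [IH] applies. Its period
    lies in [H] because it lies in one coset of [H], and is not [H] because [a + b + h] is
    missing. *)
Lemma missing_coset_sumset A' B' :
  A' != fset0 -> B' != fset0 -> A' `<=` A -> B' `<=` B ->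
  (forall x y, x \in A' -> y \in B' -> x + y - (a + b) \in H) ->
  exists K, in_missing_coset (sumset A' B') K /\
  (#|` sumset A' K| + #|` sumset B' K| <= #|` sumset A' B'| + #|` K|)%N.
Proof.
move=> A0 B0 AA BB ABH; set E := sumset A' B'.
have EAB : E `<=` sumset A B by apply: sumsetS.
have E0 : E != fset0 by apply: sumset_neq0.
have EH z : z \in E -> z - (a + b) \in H.
  by case/sumsetP=> x [y [xA yB ->]]; apply: ABH.
have EC z : z \in E -> z \notin C.
  by move=> zE; apply: missing_coset_disjoint (EH _ zE); apply: (fsubsetP EAB).
have ltE : (#|` E| < #|` sumset A B|)%N.
  have Cgt : (0 < #|` C|)%N by rewrite cardfs_gt0; case: convC.
  by apply: leq_trans (leq_cardfs_disjoint EAB CAB EC); rewrite -addn1 leq_add2l.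
have [K [sK pK leK]] := IH A0 B0 ltE.
have /fset0Pn[z zE] := E0.
have KH : K `<=` H.
  apply/fsubsetP=> k kK; have := EH _ (periodicD pK zE kK).
  by move/(fun u => subgroupB sH u (EH _ zE)); rewrite opprB addrA subrK addrC addKr.
exists K; split=> //; split; split=> //; last first.
  by apply/fsubsetP=> w wE; rewrite mem_coset EH.
rewrite ltnNge; apply: contra abh => HK.
have KE : K = H by apply/eqP; rewrite eqEfcard KH.
apply: (fsubsetP EAB); apply: (periodic_eqmod pK zE); rewrite KE.
by rewrite addrAC (subgroupD sH) // (subgroup_opp sH) // EH.
Qed.

Lemma convergent_extend E K : in_missing_coset E K ->
  (#|` sumset (A `|` B) K| + #|` H| <=
   #|` sumset (A `|` B) H| + #|` E| + #|` K|)%N ->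
  exists C' H', convergent A B C' H' /\ (#|` H'| < #|` H|)%N.
Proof.
move=> [[sK pK KH ltK EAB] [_ EC _]] le; exists (C `|` E), K; split=> //.
case: convC => _ _ C0 _ leC; split=> //.
- rewrite /periodic sumsetUl fsubUset; apply/andP; split.
    apply: fsubset_trans (fsubsetUl _ _); apply: fsubset_trans pC.
    exact: sumsetS.
  exact: fsubset_trans pK (fsubsetUr _ _).
- by apply: fsubset_neq0 C0; apply: fsubsetUl.
- by rewrite fsubUset CAB.
have CE : (#|` C| + #|` E| <= #|` C `|` E|)%N.
  apply: leq_cardfs_disjoint; rewrite ?fsubsetUl ?fsubsetUr // => x xC.
  by apply: contraL xC => /EC.
clear -le leC CE; lia.
Qed.

(** Outside [c + H] the hull under [K] lies in the hull under [H], and the latter contains all of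
    [c + H]. *)
Lemma card_holes c K : K `<=` H -> c \in A `|` B ->
  (#|` sumset (A `|` B) K| + #|` H| <= #|` sumset (A `|` B) H| +
   #|` sumset (slice (A `|` B) c) K|)%N.
Proof.
move=> KH cAB; set U := slice _ _.
set W := sumset (A `|` B) H `\` coset c H.
have cov : sumset (A `|` B) K `<=` W `|` sumset U K.
  apply/fsubsetP=> _ /sumsetP[x [k [xAB kK ->]]].
  rewrite in_fsetU in_fsetD mem_coset; case: (boolP (x - c \in H)) => xc.
    by apply/orP; right; apply: mem_sumset => //; rewrite !inE xc -in_fsetU xAB.
  have kH := fsubsetP KH _ kK.
  rewrite (mem_sumset xAB kH) andbT; apply/orP; left; apply: contra xc => xkc.
  by apply: (subgroup_diff sH) xkc; rewrite opprD addrA subrr sub0r (subgroupN sH).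
have := leq_cardfs_cover cov.
have : (#|` coset c H| + #|` W| <= #|` sumset (A `|` B) H|)%N.
  apply: leq_cardfs_disjoint; rewrite ?fsubsetDl //.
    apply/fsubsetP=> z; rewrite mem_coset => zc.
    by rewrite -(subrK c z) addrC mem_sumset.
  by move=> z zc; rewrite in_fsetD zc.
by rewrite card_coset; clearbody W U; clear; lia.
Qed.

(** The slices are paired crosswise so that both [A1 + B1] and [A2 + B2] fall into [a + b + H]. *)
Let A1 := slice A a.
Let B1 := slice B b.
Let A2 := slice A b.
Let B2 := slice B a.

Let aA1 : a \in A1. Proof. by rewrite !inE aA subrr (subgroup0 sH). Qed.
Let bB1 : b \in B1. Proof. by rewrite !inE bB subrr (subgroup0 sH). Qed.

Lemma missing_coset1 : exists K, in_missing_coset (sumset A1 B1) K /\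
  (#|` sumset A1 K| + #|` sumset B1 K| <= #|` sumset A1 B1| + #|` K|)%N.
Proof.
apply: missing_coset_sumset.
- by apply/fset0Pn; exists a.
- by apply/fset0Pn; exists b.
- by apply/fsubsetP=> x; rewrite !inE => /andP[].
- by apply/fsubsetP=> x; rewrite !inE => /andP[].
move=> x y; rewrite !inE => /andP[_ xa] /andP[_ yb].
by rewrite opprD addrACA (subgroupD sH).
Qed.

Lemma missing_coset2 : A2 != fset0 -> B2 != fset0 ->
  exists K, in_missing_coset (sumset A2 B2) K /\
  (#|` sumset A2 K| + #|` sumset B2 K| <= #|` sumset A2 B2| + #|` K|)%N.
Proof.
move=> A20 B20; apply: missing_coset_sumset => //.
- by apply/fsubsetP=> x; rewrite !inE => /andP[].
- by apply/fsubsetP=> x; rewrite !inE => /andP[].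
move=> x y; rewrite !inE => /andP[_ xb] /andP[_ ya].
by rewrite [a + b]addrC opprD addrACA (subgroupD sH).
Qed.

(** In each case some coset of [H] meets the union of [A] and [B] in [A1], in [B1] or in their
    union, so Kneser's bound for [A1 + B1] controls the last term of [card_holes]. *)
Lemma convergent_step_easy :
  [\/ A2 = fset0, B2 = fset0 | a - b \in H] ->
  exists C' H', convergent A B C' H' /\ (#|` H'| < #|` H|)%N.
Proof.
move=> cases; have [K [mK leK]] := missing_coset1.
have [[_ pK KH _ _] _] := mK; apply: (convergent_extend mK).
suff [c cAB leU] : exists2 c, c \in A `|` B &
    (#|` sumset (slice (A `|` B) c) K| <=
     #|` sumset A1 B1| + #|` K|)%N.
  apply: leq_trans (card_holes KH cAB) _.
  by rewrite -addnA leq_add2l.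
have leA : (#|` sumset A1 K| <= #|` sumset A1 B1| + #|` K|)%N.
  apply: leq_trans leK; exact: leq_addr.
have leB : (#|` sumset B1 K| <= #|` sumset A1 B1| + #|` K|)%N.
  apply: leq_trans leK; exact: leq_addl.
have aAB : a \in A `|` B by rewrite in_fsetU aA.
have bAB : b \in A `|` B by rewrite in_fsetU bB orbT.
case: cases => [A20|B20|abH].
- exists b => //; apply: leq_trans leB; apply: fsubset_leq_card.
  apply: sumsetS => //; apply/fsubsetP=> x; rewrite !inE => /andP[/orP[xA|->] xb] //.
  by have := in_fset0 x; rewrite -A20 !inE xA xb.
- exists a => //; apply: leq_trans leA; apply: fsubset_leq_card.
  apply: sumsetS => //; apply/fsubsetP=> x; rewrite !inE => /andP[/orP[->|xB] xa] //.
  by have := in_fset0 x; rewrite -B20 !inE xB xa.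
exists a => //; apply: leq_trans leK; apply: leq_cardfs_cover.
rewrite -sumsetUl; apply: sumsetS => //; apply/fsubsetP=> x.
rewrite !inE => /andP[/orP[xA|xB] xa]; first by rewrite xA xa.
by rewrite xB (subgroup_diff sH xa abH) orbT.
Qed.

Lemma card_disjoint_holes : a - b \notin H ->
  (#|` A `|` B| + 2 * #|` H| <= #|` sumset (A `|` B) H| +
   (#|` A1| + #|` B1| + #|` A2| + #|` B2|))%N.
Proof.
move=> nab; set W := sumset (A `|` B) H; set W' := W `\` (coset a H `|` coset b H).
have sW c : c \in A `|` B -> coset c H `<=` W.
  by move=> cAB; apply/fsubsetP=> z; rewrite mem_coset => zc; rewrite -(subrK c z) addrC mem_sumset.
have WW : (#|` W'| + #|` coset a H `|` coset b H| <= #|` W|)%N.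
  apply: leq_cardfs_disjoint; first exact: fsubsetDl.
    by rewrite fsubUset !sW // in_fsetU (aA, bB) ?orbT.
  by move=> x; rewrite in_fsetD => /andP[].
have HH : (#|` coset a H| + #|` coset b H| <= #|` coset a H `|` coset b H|)%N.
  apply: leq_cardfs_disjoint; rewrite ?fsubsetUl ?fsubsetUr // => x.
  rewrite !mem_coset => xa; apply: contra nab => xb.
  exact: (subgroup_diff sH (subgroup_opp sH xa) xb).
have cov : A `|` B `<=` (W' `|` A1 `|` B1) `|` (A2 `|` B2).
  apply/fsubsetP=> x xAB; have xW : x \in W.
    by apply: (fsubsetP (sub_sumset_subgroup sH _)).
  move: xAB; rewrite !(in_fsetU, in_fsetD, mem_coset) xW !inE.
  by case: (x \in A); case: (x \in B); case: (x - a \in H); case: (x - b \in H).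
have c1 := leq_cardfs_cover cov.
have c2 := leq_cardfs_cover (fsubset_refl (W' `|` A1 `|` B1)).
have c3 := leq_cardfs_cover (fsubset_refl (W' `|` A1)).
have c4 := leq_cardfs_cover (fsubset_refl (A2 `|` B2)).
rewrite !card_coset in HH.
clearbody W' W; clear -WW HH c1 c2 c3 c4; lia.
Qed.

(** The complement of [E] in [a + b + H] is [K]-periodic with fewer than twice as many elements as
    [K], hence is at most one coset of [K]. *)
Lemma convergent_extend_big E K : in_missing_coset E K ->
  (#|` H| < #|` E| + 2 * #|` K|)%N ->
  exists C' H', convergent A B C' H' /\ (#|` H'| < #|` H|)%N.
Proof.
move=> mE ltH; apply: (convergent_extend mE).
have [[sK pK KH _ _] [EH _ _]] := mE.
set F := coset (a + b) H `\` E.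
have pF : periodic K F.
  apply/fsubsetP=> _ /sumsetP[x [k [xF kK ->]]].
  move: xF; rewrite !in_fsetD !mem_coset => /andP[xE xH].
  rewrite addrAC (subgroupD sH xH (fsubsetP KH _ kK)) andbT.
  apply: contra xE => xk; apply: (periodic_eqmod pK xk).
  by rewrite opprD addrA subrr sub0r (subgroupN sK).
have cF : (#|` F| + #|` E| = #|` H|)%N.
  have := fsubset_leq_card EH; rewrite /F (cardfsDS EH) card_coset.
  exact: subnK.
have := periodic_card_lt2 sK pF.
have : (#|` sumset (A `|` B) K| <= #|` sumset (A `|` B) H|)%N.
  by apply/fsubset_leq_card/sumsetS.
clearbody F; clear -cF ltH; lia.
Qed.

Lemma convergent_step : (#|` sumset A B| < #|` A| + #|` B|)%N ->
  exists C' H', convergent A B C' H' /\ (#|` H'| < #|` H|)%N.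
Proof.
move=> ltAB.
case: (eqVneq A2 fset0) => [A20|A20]; first exact/convergent_step_easy/Or31.
case: (eqVneq B2 fset0) => [B20|B20]; first exact/convergent_step_easy/Or32.
case: (boolP (a - b \in H)) => ab; first exact/convergent_step_easy/Or33.
have [K1 [m1 le1]] := missing_coset1.
have [K2 [m2 le2]] := missing_coset2 A20 B20.
have holes := card_disjoint_holes ab.
have [[s1 _ _ _ E1AB] [_ E1C _]] := m1.
have [[s2 _ _ _ E2AB] [_ E2C _]] := m2.
set E1 := sumset A1 B1 in m1 le1 E1AB E1C; set E2 := sumset A2 B2 in m2 le2 E2AB E2C.
have leE : (#|` C| + #|` E1 `|` E2| <= #|` sumset A B|)%N.
  apply: leq_cardfs_disjoint => //; first by rewrite fsubUset E1AB E2AB.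
  by move=> x xC; apply: contraL xC => /fsetUP[/E1C|/E2C].
have leC : (#|` A `&` B| + #|` sumset (A `|` B) H| <= #|` C| + #|` H|)%N by case: convC.
have U1 := cardfsUI A B; have U2 := cardfsUI E1 E2.
have I1 := fsubset_leq_card (fsubsetIl E1 E2).
have I2 := fsubset_leq_card (fsubsetIr E1 E2).
have a1 := leq_card_sumset_subgroup s1 A1; have b1 := leq_card_sumset_subgroup s1 B1.
have a2 := leq_card_sumset_subgroup s2 A2; have b2 := leq_card_sumset_subgroup s2 B2.
(* Together the estimates bound the size of [H] strictly by the sum of the sizes of the intersection
   of [E1] and [E2], of [K1] and of [K2]. The larger of the two periods therefore qualifies for
   [convergent_extend_big]. *)
have [le12|le21] := leqP #|` K2| #|` K1|.
  apply: (convergent_extend_big m1); rewrite -/E1.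
  clearbody E1 E2; clear -ltAB le1 le2 holes leE leC U1 U2 I1 I2 a1 b1 a2 b2 le12; lia.
apply: (convergent_extend_big m2); rewrite -/E2.
clearbody E1 E2; clear -ltAB le1 le2 holes leE leC U1 U2 I1 I2 a1 b1 a2 b2 le21; lia.
Qed.
End Step.

(** While the bound fails and [H] does not stabilize the sumset, [convergent_step] shrinks [H]. Once
    [H] lies in the stabilizer, convergence itself yields the bound, as union and intersection have
    together the size of [A] plus that of [B]. *)
Lemma convergent_bound A B C H :
  (forall A' B', A' != fset0 -> B' != fset0 ->
    (#|` sumset A' B'| < #|` sumset A B|)%N -> kneser_bound A' B') ->
  convergent A B C H -> sumset A B != fset0 ->
  (#|` A| + #|` B| <= #|` sumset A B| + #|` stab (sumset A B)|)%N.
Proof.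
move=> IH; have [m] := ubnP #|` H|; elim: m C H => // m IHm C H ltH conv AB0.
case: (boolP (H `<=` stab (sumset A B))) => [HS|/fsubsetPn[h hH]].
  have [sH _ _ CAB] := conv; rewrite -(cardfsUI A B) [X in (X <= _)%N]addnC => leC.
  apply: (@leq_trans (#|` C| + #|` H|)%N); last first.
    by apply: leq_add; apply: fsubset_leq_card.
  by apply: leq_trans _ leC; rewrite leq_add2r leq_card_sumset_subgroup.
rewrite mem_stab // => /fsubsetPn[z]; rewrite mem_coset => zAB nz.
have /sumsetP[a [b [aA bB zE]]] := zAB.
have abh : a + b + h \notin sumset A B by rewrite -zE subrK.
rewrite leqNgt; apply/negP=> ltAB.
have ltAB' : (#|` sumset A B| < #|` A| + #|` B|)%N.
  by apply: leq_ltn_trans ltAB; apply: leq_addr.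
have [C' [H' [conv' lt']]] := convergent_step IH conv aA bB hH abh ltAB'.
have ltm : (#|` H'| < m)%N by apply: leq_trans lt' _.
by have := IHm C' H' ltm conv' AB0; rewrite leqNgt ltAB.
Qed.

Lemma kneser_bound_coset A B x : B != fset0 ->
  kneser_bound A (coset x B) -> kneser_bound A B.
Proof.
move=> B0 [S [sS]]; rewrite sumset_cosetr => pS leS; exists S; split=> //.
  apply/fsubsetP=> _ /sumsetP[z [k [zAB kS ->]]].
  have : z + x + k \in coset x (sumset A B).
    by apply: (periodicD pS) => //; rewrite mem_coset addrK.
  by rewrite mem_coset addrAC addrK.
by move: leS; rewrite (sumsetC (coset x B)) sumset_cosetr !card_coset (sumsetC S).
Qed.

Lemma kneser_bound_stab A B : sumset A B != fset0 ->
  periodic (stab (sumset A B)) A -> periodic (stab (sumset A B)) B ->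
  (#|` A| + #|` B| <= #|` sumset A B| + #|` stab (sumset A B)|)%N ->
  kneser_bound A B.
Proof.
move=> AB0 pA pB le; have sS := stab_subgroup AB0.
exists (stab (sumset A B)); split=> //; first exact: stab_periodic.
by rewrite !(periodicP sS).
Qed.

(** The sumset of intersection and union lies in [A + B]. If it is smaller, [IH] applies; if it is
    equal, [IH'] does, since the intersection loses [a']. The resulting bound makes this sumset a
    first convergent set. *)
Lemma kneser_inter A B (S := stab (sumset A B)) a a' :
  a \in A -> a \in B -> a' \in A -> a' \notin B ->
  periodic S A -> periodic S B ->
  (forall A' B', A' != fset0 -> B' != fset0 ->
    (#|` sumset A' B'| < #|` sumset A B|)%N -> kneser_bound A' B') ->
  (forall A' B', A' != fset0 -> B' != fset0 -> sumset A' B' = sumset A B ->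
    periodic S A' -> periodic S B' -> (#|` A'| < #|` A|)%N -> kneser_bound A' B') ->
  kneser_bound A B.
Proof.
move=> aA aB a'A a'B pA pB IH IH'.
have AB0 : sumset A B != fset0 by apply/fset0Pn; exists (a + a); apply: mem_sumset.
have I0 : A `&` B != fset0 by apply/fset0Pn; exists a; rewrite in_fsetI aA.
have U0 : A `|` B != fset0 by apply/fset0Pn; exists a; rewrite in_fsetU aA.
have sub : sumset (A `&` B) (A `|` B) `<=` sumset A B.
  apply/fsubsetP=> _ /sumsetP[x [y [/fsetIP[xA xB] /fsetUP[yA|yB] ->]]].
    by rewrite addrC mem_sumset.
  exact: mem_sumset.
apply: kneser_bound_stab => //.
have [T [sT pT leT]] : kneser_bound (A `&` B) (A `|` B).
  have := fsubset_leq_card sub; rewrite leq_eqVlt => /orP[eqc|ltc]; last exact: IH.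
  have E : sumset (A `&` B) (A `|` B) = sumset A B.
    by apply/eqP; rewrite eqEfcard sub (eqP eqc) leqnn.
  apply: IH' => //.
  - rewrite /periodic fsubsetI; apply/andP; split.
      by apply: fsubset_trans pA; apply: sumsetS (fsubsetIl _ _) _.
    by apply: fsubset_trans pB; apply: sumsetS (fsubsetIr _ _) _.
  - by rewrite /periodic sumsetUl; apply: fsetUSS.
  apply: fproper_ltn_card; rewrite fproperEneq fsubsetIl andbT.
  by apply: contraNneq a'B => E'; move: a'A; rewrite -{1}E' in_fsetI => /andP[].
apply: (@convergent_bound A B (sumset (A `&` B) (A `|` B)) T IH _ AB0).
split=> //; first exact: sumset_neq0.
by apply: leq_trans leT; rewrite leq_add2r leq_card_sumset_subgroup.
Qed.

Lemma stab_coset C x : C != fset0 -> stab (coset x C) = stab C.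
Proof.
move=> C0; have xC0 : coset x C != fset0 by rewrite -cardfs_gt0 card_coset cardfs_gt0.
apply/fsetP=> y; rewrite !mem_stab //; apply/fsubsetP/fsubsetP=> sub z.
  rewrite mem_coset => zC; have := sub (z + x); rewrite !mem_coset addrK; apply.
  by rewrite addrAC addrK.
by rewrite !mem_coset => zC; apply: sub; rewrite mem_coset addrAC.
Qed.

Lemma kneser_periodic A B (S := stab (sumset A B)) :
  A != fset0 -> B != fset0 -> periodic S A -> periodic S B ->
  (forall A' B', A' != fset0 -> B' != fset0 ->
    (#|` sumset A' B'| < #|` sumset A B|)%N -> kneser_bound A' B') ->
  kneser_bound A B.
Proof.
move=> A0 B0 pA pB IH; have [j] := ubnP #|` A|; rewrite /S {S} in pA pB *.
elim: j A B A0 B0 pA pB IH => // j IHj A B A0 B0 pA pB IH ltj.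
have AB0 := sumset_neq0 A0 B0; set S := stab _ in pA pB.
have sS : subgroup S := stab_subgroup AB0.
have /fset0Pn[a aA] := A0.
case: (boolP (A `<=` coset a S)) => [/fsubset_leq_card|/fsubsetPn[a' a'A]].
  rewrite card_coset => leA; apply: kneser_bound_stab => //.
  by rewrite addnC leq_add // (leq_card_sumsetr _ aA).
rewrite mem_coset mem_stab // => na.
(* As [a' - a] does not stabilize [A + B], it does not stabilize [B]. Translating [B] by [a - b]
   then catches [a] and misses [a']. *)
have [b bB nb] : exists2 b, b \in B & b + (a' - a) \notin B.
  case: (boolP (coset (a' - a) B `<=` B)) => [sB|/fsubsetPn[z]].
    by case/negP: na; rewrite -sumset_cosetr; apply: sumsetS.
  by rewrite mem_coset => zB nz; exists (z - (a' - a)); rewrite ?subrK.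
apply: (@kneser_bound_coset _ _ (a - b)) => //; set B' := coset _ B.
have sumE : sumset A B' = coset (a - b) (sumset A B) := sumset_cosetr _ _ _.
have B'0 : B' != fset0 by apply/fset0Pn; exists a; rewrite mem_coset subKr.
have stE : stab (sumset A B') = S by rewrite sumE stab_coset.
have pB' : periodic S B'.
  apply/fsubsetP=> _ /sumsetP[x [k [xB kS ->]]].
  by move: xB; rewrite !mem_coset addrAC => xB; apply: (periodicD pB).
have IH2 A1 B1 : A1 != fset0 -> B1 != fset0 ->
    (#|` sumset A1 B1| < #|` sumset A B'|)%N -> kneser_bound A1 B1.
  by rewrite sumE card_coset; apply: IH.
apply: (@kneser_inter A B' a a'); rewrite ?stE //.
- by rewrite mem_coset subKr.
- by rewrite mem_coset opprB addrCA.
move=> A1 B1 A10 B10 E p1 p2 lt1.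
by apply: IHj; rewrite ?E ?stE //; apply: leq_trans lt1 _.
Qed.

Theorem kneser A B : A != fset0 -> B != fset0 -> kneser_bound A B.
Proof.
have [k] := ubnP #|` sumset A B|; elim: k A B => // k IHk A B ltk A0 B0.
have AB0 := sumset_neq0 A0 B0; have sS := stab_subgroup AB0.
have pS := stab_periodic AB0; set S := stab _ in sS pS.
(* Filling up both summands by the stabilizer keeps the sumset and leads to the periodic case. *)
have sumE : sumset (sumset A S) (sumset B S) = sumset A B.
  rewrite -sumsetA (sumsetC S) (periodicP sS (periodic_sumset sS _)).
  by rewrite sumsetA (periodicP sS).
have nz X : X != fset0 -> sumset X S != fset0.
  by move=> X0; apply: sumset_neq0 => //; rewrite -cardfs_gt0 subgroup_gt0.
have [||||A' B' A'0 B'0|T [sT pT leT]] := @kneser_periodic (sumset A S) (sumset B S).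
- exact: nz.
- exact: nz.
- by rewrite sumE; apply: periodic_sumset.
- by rewrite sumE; apply: periodic_sumset.
- by rewrite sumE => lt; apply: IHk => //; apply: leq_trans lt _.
exists T; rewrite sumE in pT leT; split=> //; apply: leq_trans leT.
by apply: leq_add; apply/fsubset_leq_card/sumsetS => //; apply: sub_sumset_subgroup.
Qed.
End Kneser.

(** * Wrapping around a cyclic subgroup *)

(* In the notation of section [Wrap] below, [n], [a], [M], [mu], [ka], [La],
   [ab], [s], [EA] are the cardinalities of [psi @` A], [A], [2A], [E], [K],
   [AK], [A'], [2A'] and [E + A]. *)
Section Counting.
Local Open Scope nat_scope.
Variables n a M mu ka La ab s EA : nat.
Hypotheses (n2 : 2 <= n) (aE : ab + mu = a) (EAa : a <= EA) (EAn : n * mu <= EA).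
Hypotheses (kn : 2 * La <= s + ka) (La2 : 2 * ka <= La) (abL : ab <= La).
Hypothesis sM : s + EA <= M.

(** [EA] dominates both [a] and [n * mu], hence their mean with weights [1 - 2/n] and [2/n]. *)
Lemma count_EA : n * a + 2 * (n * mu) <= n * EA + 2 * a.
Proof.
clear aE kn La2 abL sM; have [le|lt] := leqP (n * mu) a.
  have : n * a <= n * EA by rewrite leq_mul2l EAa orbT.
  lia.
have h1 : n * (n * mu) <= n * EA by rewrite leq_mul2l EAn orbT.
move: (n * mu) lt EAn h1 => y lt EAn' h1.
nia.
Qed.

(** With this many holes of [A'] in its hull, Kneser's bound [2 * La - ka] is at least
    [2 * ab - a/n], and [count_EA] supplies the rest. *)
Lemma count_dense : n * ka + 2 * (n * ab) <= 2 * (n * La) + a -> 3 * (n * a) <= n * M + 3 * a.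
Proof.
move=> H; have := count_EA.
have : n * (2 * La + EA) <= n * (M + ka) by rewrite leq_mul2l; lia.
have : n * ab + n * mu = n * a by rewrite -mulnDr aE.
lia.
Qed.

(** For the case that [E + A] leaves the hull of [A'] and so gains [aw] elements over [A]. The gain
    suffices for small [mu]; for large [mu] the bound [EAn] takes over. *)
Lemma count_spread aw : a + aw <= EA -> ka + ab <= La + aw -> 3 * (n * a) <= n * M + 3 * a.
Proof.
move=> H1 H2.
have [le|lt] := leqP (2 * (n * mu)) (3 * a).
  have H3 : 3 * a <= M + 2 * mu by lia.
  have : n * (3 * a) <= n * (M + 2 * mu) by rewrite leq_mul2l H3 orbT.
  lia.
have H3 : 2 * La + n * mu <= M + ka by lia.
have H4 : n * (2 * La + n * mu) <= n * (M + ka) by rewrite leq_mul2l H3 orbT.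
have H5 : n * (2 * ka + 4 * ab) <= n * (a + 4 * La) by rewrite leq_mul2l; lia.
have H6 : n * ab + n * mu = n * a by rewrite -mulnDr aE.
have H7 : (n - 2) * (3 * a) <= (n - 2) * (2 * (n * mu)).
  by rewrite leq_mul2l (ltnW lt) orbT.
clear -n2 H4 H5 H6 H7; nia.
Qed.

(** Here [x] counts a sum of two coset parts of sizes [au] and [av], with a period of size [sp] at
    most half of the torsion part's size [q]. The loss [q/2] is affordable because
    [n * q <= 2 * a]. *)
Lemma count_small_period q sp x au av :
  s + EA + x <= M + ka -> ka + ab <= La + au -> ka + ab <= La + av ->
  2 * (n * La) + a < n * ka + 2 * (n * ab) ->
  au + av <= x + sp -> 2 * sp <= q -> n.-1 * q <= La -> q <= ka ->
  3 * (n * a) <= n * M + 3 * a.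
Proof.
move=> H1 H2 H3 H4 H5 H6 H7 H8.
have H9 := count_EA.
have D : 2 * La < ka + 2 * ab.
  rewrite -(@ltn_pmul2l n) ?mulnDr ?(mulnCA n 2); lia.
have nq : n * q <= 2 * a.
  have -> : n * q = n.-1 * q + q by rewrite -mulSnr prednK //; lia.
  lia.
have H10 : n * (4 * ab + 2 * EA) <= n * (2 * M + q) by rewrite leq_mul2l; lia.
have : n * ab + n * mu = n * a by rewrite -mulnDr aE.
lia.
Qed.

(** The period is now the whole torsion part, so [au], [av] and [ak] refer to sets filled up by it.
    The loss [q] is balanced by [n.-1 * q <= ak]. *)
Lemma count_full_period q x au av ak :
  s + EA + x <= M + ka -> ka + ak <= La + au -> ka + ak <= La + av ->
  au + av <= x + q -> n.-1 * q <= ak -> ab <= ak ->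
  3 * (n * a) <= n * M + 3 * a.
Proof.
move=> H1 H2 H3 H5 H7 H8.
have H9 := count_EA.
have H10 : n * (2 * ak + EA) <= n * (M + q) by rewrite leq_mul2l; lia.
have H11 : n * ab + n * mu = n * a by rewrite -mulnDr aE.
have nq : n * q = n.-1 * q + q by rewrite -mulSnr prednK //; lia.
have H12 : n * ab <= n * ak by rewrite leq_mul2l H8 orbT.
have [le|lt] := leqP mu q.
  have : (2 * n) * ab + 3 * ak <= (2 * n) * ak + 3 * ab by clear -n2 H8; nia.
  have : n * a <= n * EA by rewrite leq_mul2l EAa orbT.
  have : (2 * n) * mu + 3 * q <= (2 * n) * q + 3 * mu by clear -n2 le; nia.
  by clear -H8 H10 H11 nq H7 aE; lia.
have : n * ab + 2 * ak <= n * ak + 2 * ab by clear -n2 H8; nia.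
by clear -H8 H9 H10 H11 nq lt H7 aE; lia.
Qed.

End Counting.

Lemma cardfsM (T1 T2 : choiceType) (X : {fset T1}) (Y : {fset T2}) :
  #|` X `*` Y| = (#|` X| * #|` Y|)%N.
Proof.
rewrite card_fset_sum1 big_imfset2 => [|[? ?] [? ?] _ _ /= [-> ->] //].
rewrite (eq_bigr (fun=> #|` Y|)) => [|x _]; last by rewrite -card_fset_sum1.
by rewrite big_const_seq count_predT iter_addn_0 mulnC.
Qed.

Lemma leq_cardfs_mul (T1 T2 T3 : choiceType) (X : {fset T1}) (Y : {fset T2})
    (W : {fset T3}) (f : T1 -> T2 -> T3) :
  (forall x y, x \in X -> y \in Y -> f x y \in W) ->
  (forall x y x' y', x \in X -> y \in Y -> x' \in X -> y' \in Y ->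
    f x y = f x' y' -> x = x' /\ y = y') ->
  (#|` X| * #|` Y| <= #|` W|)%N.
Proof.
move=> fW finj; rewrite -cardfsM.
apply: (@leq_cardfs_in_inj _ _ (fun u => f u.1 u.2)) => [[x y] [x' y']|[x y]];
  rewrite !in_fsetM /=; last by case/andP=> *; apply: fW.
by move=> /andP[xX yY] /andP[x'X y'Y] /finj[] // -> ->.
Qed.

(** * The quotient by an infinite cyclic subgroup *)

Section CyclicQuotient.
Variables (G : zmodType) (psi : {additive G -> int}) (g : G).

(* Membership in the cyclic group of [g] is decidable because [psi] reads off
   the only possible multiple. *)
Definition cycle_pred : {pred G} := fun x => x == g *~ (psi x %/ psi g)%Z.

Lemma cycle_predP x : psi g != 0 -> reflect (exists j, x = g *~ j) (x \in cycle_pred).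
Proof.
move=> g0; apply: (iffP eqP) => [->|[j ->]]; first by exists (psi x %/ psi g)%Z.
by rewrite raddfMz -mulrzr intz mulrC mulzK.
Qed.

Lemma cycle_pred_zmod : psi g != 0 -> zmod_closed cycle_pred.
Proof.
move=> g0; split=> [|x y]; first by apply/cycle_predP => //; exists 0; rewrite mulr0z.
move=> /(cycle_predP _ g0)[i ->] /(cycle_predP _ g0)[j ->].
by apply/cycle_predP => //; exists (i - j); rewrite mulrzBr.
Qed.

Lemma cyclic_quotient : psi g != 0 -> exists (Q : zmodType) (phi : {additive G -> Q}),
  forall x, phi x = 0 <-> exists j, x = g *~ j.
Proof.
move=> g0.
pose I : zmodClosed G :=
  HB.pack cycle_pred (GRing.isZmodClosed.Build G cycle_pred (cycle_pred_zmod g0)).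
pose Q : zmodType := Quotient.quot I.
pose phi : {additive G -> Q} := \pi_(Quotient.quot I)%qT.
exists Q, phi => x; have E : (phi x == 0) = (x \in cycle_pred).
  by rewrite -(raddf0 phi) -[x in RHS]subr0; apply/esym/(Quotient.idealrBE I).
split=> [/eqP|jP]; first by rewrite E => /(cycle_predP _ g0).
by apply/eqP; rewrite E; apply/cycle_predP.
Qed.
End CyclicQuotient.

(** Serves to pick one element of [A] at each height. *)
Lemma fset_section (T1 T2 : choiceType) (f : T1 -> T2) (A : {fset T1}) :
  A != fset0 -> exists r : T2 -> T1, forall x, x \in A -> r (f x) \in A /\ f (r (f x)) = f x.
Proof.
case/fset0Pn=> x0 _; pose p v x := f x == v.
exists (fun v => nth x0 A (find (p v) A)) => x xA.
have hx : has (p (f x)) A by apply/hasP; exists x => //; apply/eqP.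
by split; [apply: mem_nth; rewrite -has_find | apply/eqP/(nth_find x0 hx)].
Qed.

Lemma card_imfset_ord (T : choiceType) N (f : 'I_N -> T) :
  injective f -> #|` [fset f j | j in 'I_N]| = N.
Proof.
move=> injf; rewrite card_imfset //= -[RHS](card_ord N) cardE.
by apply: perm_size; apply: uniq_perm; rewrite ?enum_uniq ?enum_finmem_uniq.
Qed.

Lemma mem_fimage (T1 T2 : choiceType) (f : T1 -> T2) (A : {fset T1}) x :
  x \in A -> f x \in f @` A.
Proof. by move=> xA; apply/imfsetP; exists x. Qed.

Lemma fimage_sumset (G Q : zmodType) (phi : {additive G -> Q}) (X Y : {fset G}) :
  phi @` sumset X Y = sumset (phi @` X) (phi @` Y).
Proof.
apply/fsetP=> z; apply/imfsetP/sumsetP => /=.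
  by case=> _ /sumsetP[x [y [xX yY ->]]] ->; exists (phi x), (phi y); rewrite !mem_fimage // raddfD.
case=> _ [_ [/imfsetP[x /= xX ->] /imfsetP[y /= yY ->] ->]].
by exists (x + y); rewrite ?mem_sumset // raddfD.
Qed.

(** * Counting modulo [g] *)

Section Wrap.
Variables (G : zmodType) (psi : {additive G -> int}) (A : {fset G}) (g : G).
Hypotheses (A0 : 0 \in A) (Ag : g \in A) (g0 : 0 < psi g).
Hypothesis Ah : forall x, x \in A -> 0 <= psi x <= psi g.
Variables (Q : zmodType) (phi : {additive G -> Q}).
Hypothesis phiP : forall x, phi x = 0 <-> exists j, x = g *~ j.

Let psiD x y : psi (x + y) = psi x + psi y. Proof. exact: raddfD. Qed.
Let psiB x y : psi (x - y) = psi x - psi y. Proof. exact: raddfB. Qed.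

Definition doubled_ends := [fset x in A | x + g \in A].
Local Notation E := doubled_ends.

Lemma phi_g : phi g = 0. Proof. by apply/phiP; exists 1; rewrite mulr1z. Qed.

Lemma phi_eq x y : phi x = phi y -> exists j, x = y + g *~ j /\ psi x = psi y + j * psi g.
Proof.
move=> /eqP; rewrite -subr_eq0 -raddfB => /eqP/phiP[j Ej].
have Ex : x = y + g *~ j by rewrite -Ej addrC subrK.
by exists j; split=> //; rewrite [in LHS]Ex psiD raddfMz /= -mulrzr intz mulrC.
Qed.

Lemma doubled_ends_bottom x : x \in E -> psi x = 0.
Proof. by rewrite !inE => /andP[/Ah xA /Ah]; rewrite psiD; lia. Qed.

Lemma doubled_ends0 : 0 \in E.
Proof. by rewrite !inE A0 add0r. Qed.

(** Discarding [W + g] from [X] loses no residue: subtracting [g] stays in [X] and lowers the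
    height, so after finitely many steps an element outside [W + g] is reached. *)
Lemma card_wrap (X W : {fset G}) : W `<=` X -> (forall w, w \in W -> w + g \in X) ->
  (#|` phi @` X| + #|` W| <= #|` X|)%N.
Proof.
move=> WX WgX; set Y := X `\` coset g W.
have sX : coset g W `<=` X.
  by apply/fsubsetP=> x; rewrite mem_coset => /WgX; rewrite subrK.
have pY : phi @` X `<=` phi @` Y.
  apply/fsubsetP=> _ /imfsetP[x /= xX ->].
  have [m] := ubnP #|` [fset y in X | psi y < psi x]|.
  elim: m x xX => // m IH x xX ltm.
  case: (boolP (x \in coset g W)) => xW; last by rewrite mem_fimage // in_fsetD xW.
  rewrite mem_coset in xW; have xgX := fsubsetP WX _ xW.
  have -> : phi x = phi (x - g) by rewrite raddfB /= phi_g subr0.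
  apply: IH => //; rewrite ltnS in ltm; apply: leq_trans ltm.
  apply: fproper_ltn_card; rewrite fproperE; apply/andP; split.
    by apply/fsubsetP=> y; rewrite !inE psiB => /andP[-> lty] /=; lia.
  by apply/fsubsetPn; exists (x - g); rewrite !inE xgX psiB; lia.
apply: (@leq_trans (#|` Y| + #|` coset g W|)%N).
  rewrite card_coset leq_add2r.
  exact: leq_trans (fsubset_leq_card pY) (leq_imfset_card _ _ _).
apply: leq_cardfs_disjoint (fsubsetDl _ _) sX _ => x.
by rewrite in_fsetD => /andP[].
Qed.

(** Heights in [A] differ by at most [psi g], so congruent elements differ by [0], [g] or [- g];
    hence [phi] is injective on [A] without [E + g]. *)
Lemma card_fimage_doubled : (#|` phi @` A| + #|` E| = #|` A|)%N.
Proof.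
apply/eqP; rewrite eqn_leq; apply/andP; split.
  by apply: card_wrap => [|w]; [apply/fsubsetP=> x|]; rewrite !inE => /andP[].
have cov : A `<=` (A `\` coset g E) `|` coset g E.
  by apply/fsubsetP=> x xA; rewrite in_fsetU in_fsetD xA andbT orNb.
apply: leq_trans (leq_cardfs_cover cov) _; rewrite card_coset leq_add2r.
apply: (@leq_cardfs_in_inj _ _ phi) => [x y|x]; last first.
  by rewrite in_fsetD => /andP[_ /mem_fimage]; apply.
rewrite !in_fsetD !mem_coset !inE !subrK => /andP[nx xA] /andP[ny yA] /phi_eq[j [Ex Ej]].
have [hx hy] := (Ah xA, Ah yA).
have j1 : -1 <= j <= 1 by nia.
have jE : j = 0 \/ j = 1 \/ j = -1 by lia.
case: jE Ex => [->|[->|->]]; rewrite ?mulr0z ?mulr1z ?mulrN1z => Ex; first by rewrite Ex addr0.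
  by move: nx; rewrite xA andbT Ex addrK yA.
by move: ny; rewrite yA andbT -Ex xA.
Qed.

(** All of [E] has height 0, so adding [E] to one element of [A] per height gives disjoint
    translates. *)
Lemma leq_card_doubled_sumset : (#|` psi @` A| * #|` E| <= #|` sumset E A|)%N.
Proof.
have [|r rP] := @fset_section _ _ psi A; first by apply/fset0Pn; exists 0.
apply: (@leq_cardfs_mul _ _ _ _ _ _ (fun v e => e + r v)).
  by move=> _ e /imfsetP[x /= xA ->] eE; apply: mem_sumset => //; case: (rP x xA).
move=> _ e _ e' /imfsetP[x /= xA ->] eE /imfsetP[y /= yA ->] eE' Eq.
have := congr1 psi Eq; rewrite !psiD (proj2 (rP x xA)) (proj2 (rP y yA)).
rewrite (doubled_ends_bottom eE) (doubled_ends_bottom eE') !add0r => Exy; split=> //.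
by move: Eq; rewrite Exy => /addIr.
Qed.

Lemma doubled_sumset_sub : sumset E A `<=` sumset A A.
Proof. by apply: sumsetS => //; apply/fsubsetP=> x; rewrite !inE => /andP[]. Qed.

Lemma doubled_sumset_shift w : w \in sumset E A -> w + g \in sumset A A.
Proof.
by case/sumsetP=> x [y [xE yA ->]]; rewrite addrAC mem_sumset //; move: xE; rewrite !inE => /andP[].
Qed.

Lemma leq_card_sumset_doubled :
  (#|` sumset (phi @` A) (phi @` A)| + #|` sumset E A| <= #|` sumset A A|)%N.
Proof.
rewrite -fimage_sumset; apply: card_wrap; first exact: doubled_sumset_sub.
exact: doubled_sumset_shift.
Qed.

(** * Counting coset by coset over a period of the wrapped sumset *)

Variable H : {fset G}.
Hypothesis HP : forall x, (x \in H) = (psi x == 0).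
Variable K : {fset Q}.
Hypothesis sK : subgroup K.
Local Notation A' := (phi @` A).
Local Notation AK := (sumset (phi @` A) K).
Hypothesis pK : periodic K (sumset A' A').
Hypothesis kn : (2 * #|` AK| <= #|` sumset A' A'| + #|` K|)%N.

Let phiD x y : phi (x + y) = phi x + phi y. Proof. exact: raddfD. Qed.
Let phiB x y : phi (x - y) = phi x - phi y. Proof. exact: raddfB. Qed.
Let phi0 : phi 0 = 0. Proof. exact: raddf0. Qed.
Let psi0 : psi 0 = 0. Proof. exact: raddf0. Qed.

(** In the progression case this becomes the subgroup of the conclusion. *)
Definition torsion_part := [fset x in H | phi x \in K].
Definition part (X : {fset G}) u := [fset x in X | phi x - phi u \in K].
Local Notation KH := torsion_part.

Lemma torsion_partP x : (x \in KH) = (psi x == 0) && (phi x \in K).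
Proof. by rewrite !inE HP. Qed.

Lemma torsion_part_subgroup : subgroup KH.
Proof.
split=> [|x y]; rewrite /= !torsion_partP ?psi0 ?phi0 ?(subgroup0 sK) //.
move=> /andP[/eqP x0 xK] /andP[/eqP y0 yK].
by rewrite psiB phiB x0 y0 subrr eqxx (subgroupB sK).
Qed.

Lemma leq_card_torsion_part : (#|` KH| <= #|` K|)%N.
Proof.
apply: (@leq_cardfs_in_inj _ _ phi) => [x y|x]; rewrite !torsion_partP; last by case/andP.
move=> /andP[/eqP x0 _] /andP[/eqP y0 _] /phi_eq[j []].
rewrite x0 y0 => -> Ej; have -> : j = 0 by nia.
by rewrite mulr0z addr0.
Qed.

(** The holes that the image of [X] has in the coset of [phi u] are among all its holes in its hull
    under [K]. *)
Lemma card_deficit (X : {fset G}) u : u \in X ->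
  (#|` K| + #|` phi @` X| <= #|` sumset (phi @` X) K| + #|` phi @` part X u|)%N.
Proof.
move=> uX; rewrite -(card_coset (phi u)) -cardfsUI; apply: leq_add; apply: fsubset_leq_card.
  rewrite fsubUset sub_sumset_subgroup // andbT; apply/fsubsetP=> z; rewrite mem_coset => zu.
  by rewrite -(subrK (phi u) z) addrC mem_sumset // mem_fimage.
apply/fsubsetP=> z /fsetIP[]; rewrite mem_coset => zu /imfsetP[x /= xX zE].
by rewrite zE in zu *; apply: mem_fimage; rewrite !inE xX.
Qed.

Lemma sumset_torsion_part : sumset (phi @` sumset A KH) K = AK.
Proof.
apply/eqP; rewrite eqEfsubset; apply/andP; split.
  apply: sumset_sub_periodic; first exact: periodic_sumset.
  rewrite fimage_sumset; apply: sumsetS => //.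
  by apply/fsubsetP=> _ /imfsetP[x /= + ->]; rewrite torsion_partP => /andP[].
apply: sumsetS => //; apply/fsubsetP=> _ /imfsetP[x /= xA ->]; apply: mem_fimage.
exact: (fsubsetP (sub_sumset_subgroup torsion_part_subgroup _)).
Qed.

(** Modulo [psi g] the heights of [A] below the top are distinct, so the corresponding translates of
    [KH] stay disjoint in the quotient. The top height is dropped because it agrees with height
    0. *)
Lemma leq_card_layers : ((#|` psi @` A|).-1 * #|` KH| <= #|` phi @` sumset A KH|)%N.
Proof.
have [|r rP] := @fset_section _ _ psi A; first by apply/fset0Pn; exists 0.
rewrite (cardfsD1 (psi g)) mem_fimage //=.
apply: (@leq_cardfs_mul _ _ _ _ _ _ (fun v k => phi (r v + k))).
  move=> v k /fsetD1P[_ /imfsetP[x /= xA ->]] kK; apply/mem_fimage/mem_sumset => //.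
  by case: (rP x xA).
move=> v k v' k' /fsetD1P[vg /imfsetP[x /= xA vE]] + /fsetD1P[vg' /imfsetP[x' /= xA' vE']].
rewrite !torsion_partP => /andP[/eqP k0 _] /andP[/eqP k0' _] /phi_eq[j []].
have [rA rv] := rP x xA; have [rA' rv'] := rP x' xA'.
rewrite !psiD k0 k0' vE vE' rv rv' !addr0 => Eq Ej.
have [hx hx'] := (Ah xA, Ah xA').
have j0 : j = 0.
  move/eqP: vg; move/eqP: vg'; rewrite vE vE' => ? ?; nia.
move: Eq; rewrite Ej j0 mul0r addr0 mulr0z addr0 => /addrI ->.
by [].
Qed.

Lemma AK_sub : AK `<=` sumset A' A'.
Proof.
apply: sumset_sub_periodic => //; apply/fsubsetP=> x xA.
by rewrite -(addr0 x) mem_sumset // -phi0 mem_fimage.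
Qed.

(** Split [sumset A A] into the part over [AK], where [card_wrap] gains all of [E + A], the part
    over the coset of [phi (u + v)], counted in [G] itself, and the rest, counted in the
    quotient. *)
Lemma card_sumset_confined u v :
  phi @` sumset E A `<=` AK -> u \in A -> v \in A -> phi (u + v) \notin AK ->
  (#|` sumset A' A'| + #|` sumset E A| + #|` sumset (part A u) (part A v)| <=
   #|` sumset A A| + #|` K|)%N.
Proof.
move=> EAK uA vA nuv.
set X1 := [fset x in sumset A A | phi x \in AK].
set X2 := [fset x in sumset A A | phi x - phi (u + v) \in K].
set X3 := sumset A A `\` (X1 `|` X2).
have c1 : (#|` AK| + #|` sumset E A| <= #|` X1|)%N.
  apply: (@leq_trans (#|` phi @` X1| + #|` sumset E A|)%N).
    rewrite leq_add2r; apply: fsubset_leq_card; apply/fsubsetP=> y yAK.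
    have := fsubsetP AK_sub _ yAK; rewrite -fimage_sumset => /imfsetP[x /= xA yE].
    by rewrite yE mem_fimage // !inE xA -yE yAK.
  have EK w : w \in sumset E A -> phi w \in AK.
    by move=> wE; apply/(fsubsetP EAK)/mem_fimage.
  apply: card_wrap => [|w wE]; first apply/fsubsetP=> w wE; rewrite !inE.
    by rewrite EK // (fsubsetP doubled_sumset_sub).
  by rewrite doubled_sumset_shift // phiD phi_g addr0 EK.
have c2 : (#|` sumset (part A u) (part A v)| <= #|` X2|)%N.
  apply: fsubset_leq_card; apply/fsubsetP=> _ /sumsetP[x [y [xu yv ->]]].
  move: xu yv; rewrite !inE => /andP[xA xu] /andP[yA yv].
  by rewrite mem_sumset // !phiD opprD addrACA (subgroupD sK).
have c3 : (#|` sumset A' A'| <= #|` AK| + #|` K| + #|` X3|)%N.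
  set c := phi (u + v).
  apply: (@leq_trans (#|` AK `|` coset c K| + #|` phi @` X3|)%N).
    apply: leq_cardfs_cover; rewrite -fimage_sumset; apply/fsubsetP=> _ /imfsetP[x /= xA ->].
    rewrite !in_fsetU mem_coset.
    case: (boolP (phi x \in AK)) => //= n1; case: (boolP (_ \in K)) => //= n2.
    by apply: mem_fimage; rewrite in_fsetD in_fsetU xA andbT !inE xA (negPf n1) (negPf n2).
  apply: leq_add (leq_imfset_card _ _ _); rewrite -(card_coset c K).
  exact: leq_cardfs_cover.
have c12 : (#|` X1| + #|` X2| <= #|` X1 `|` X2|)%N.
  apply: leq_cardfs_disjoint; rewrite ?fsubsetUl ?fsubsetUr // => x.
  rewrite !inE => /andP[-> xK] /=; apply: contra nuv => xuv.
  exact: (periodic_eqmod (periodic_sumset sK _) xK (subgroup_opp sK xuv)).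
have c123 : (#|` X3| + #|` X1 `|` X2| <= #|` sumset A A|)%N.
  apply: leq_cardfs_disjoint; first exact: fsubsetDl.
    by rewrite fsubUset; apply/andP; split; apply/fsubsetP=> x; rewrite !inE => /andP[].
  by move=> x; rewrite in_fsetD => /andP[].
clearbody X1 X2 X3; clear -c1 c2 c3 c12 c123; lia.
Qed.

(** [A] lies in [E + A] because [0] is in [E]; the part of [w] translated by [e] lies over a coset
    outside [AK] and so avoids [A]. *)
Lemma card_doubled_spread e w : e \in E -> w \in A -> phi (e + w) \notin AK ->
  (#|` A| + #|` part A w| <= #|` sumset E A|)%N.
Proof.
move=> eE wA nw; rewrite -(card_coset e (part A w)); apply: leq_cardfs_disjoint.
- apply/fsubsetP=> x xA; rewrite -(add0r x); apply: mem_sumset => //; exact: doubled_ends0.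
- apply/fsubsetP=> z; rewrite mem_coset !inE => /andP[zA _].
  by rewrite -(subrK e z) addrC mem_sumset.
move=> z zA; rewrite mem_coset !inE; apply/negP=> /andP[_ zw]; case/negP: nw.
apply: (periodic_eqmod (periodic_sumset sK _) (x := phi z)).
  exact/(fsubsetP (sub_sumset_subgroup sK _))/mem_fimage.
by apply: (subgroup_opp sK); rewrite phiD opprD addrA -phiB.
Qed.

(** An element of [S] of nonzero height, added repeatedly, would carry [X] out of the height range
    of [sumset A A], whose width is [2 * psi g]. *)
Lemma period_sub_torsion (S X : {fset G}) : X != fset0 -> X `<=` sumset A A ->
  (forall x y, x \in X -> y \in X -> phi x - phi y \in K) ->
  subgroup S -> periodic S X -> S `<=` KH.
Proof.
move=> /fset0Pn[x xX] XA XK sS pS; apply/fsubsetP=> k kS.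
rewrite torsion_partP; apply/andP; split; last first.
  by have := XK _ _ (periodicD pS xX kS) xX; rewrite phiD addrC addKr.
have XP i : x + k *+ i \in X.
  elim: i => [|i IH]; first by rewrite mulr0n addr0.
  by rewrite mulrSr addrA (periodicD pS).
have bnd y : y \in X -> 0 <= psi y <= 2 * psi g.
  by move=> /(fsubsetP XA)/sumsetP[a [b [/Ah aA /Ah bA ->]]]; rewrite psiD; lia.
have := bnd _ (XP (absz (2 * psi g)).+1); have := bnd _ xX.
rewrite psiD raddfMn /= -mulr_natr natz; move: (psi k) (psi x) (psi g) => c d l; nia.
Qed.

Lemma count_doubling : (1 < #|` psi @` A|)%N -> (2 * #|` K| <= #|` AK|)%N ->
  (3 * (#|` psi @` A| * #|` A|) <= #|` psi @` A| * #|` sumset A A| + 3 * #|` A|)%N.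
Proof.
move=> n2 K2; set n := #|` psi @` A| in n2 *.
have aE := card_fimage_doubled.
have EA : (#|` A| <= #|` sumset E A|)%N by apply: leq_card_sumsetr doubled_ends0.
have EAn := leq_card_doubled_sumset; rewrite -/n in EAn.
have abL := leq_card_sumset_subgroup sK A'.
have sM := leq_card_sumset_doubled.
have part_le u : (#|` phi @` part A u| <= #|` part A u|)%N := leq_imfset_card _ _ _.
have def u : u \in A -> (#|` K| + #|` A'| <= #|` AK| + #|` part A u|)%N.
  by move=> uA; apply: leq_trans (card_deficit uA) _; rewrite leq_add2l.
have [dense|sparse] := leqP (n * #|` K| + 2 * (n * #|` A'|)) (2 * (n * #|` AK|) + #|` A|).
  exact: (count_dense n2 aE EA EAn kn K2 abL sM dense).
case: (boolP (phi @` sumset E A `<=` AK)) => [conf|/fsubsetPn[_ /imfsetP[x /= xEA ->]]]; last first.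
  have /sumsetP[e [w [eE wA ->]]] := xEA => nw.
  have spread := card_doubled_spread eE wA nw.
  exact: (count_spread n2 aE EA EAn kn K2 abL sM spread (def w wA)).
(* By Kneser's bound and [K2] the wrapped sumset is larger than [AK]; this yields a coset of [K]
   outside [AK]. *)
have /fsubsetPn[_ /sumsetP[_ [_ [/imfsetP[u /= uA ->] /imfsetP[v /= vA ->] ->]]]] :
    ~~ (sumset A' A' `<=` AK).
  apply/negP=> /fsubset_leq_card; have := subgroup_gt0 sK; lia.
rewrite -phiD => nuv; have cM := card_sumset_confined conf uA vA nuv.
have upart z : z \in A -> z \in part A z.
  by move=> zA; rewrite !inE zA subrr (subgroup0 sK).
have [||S [sS pS leS]] := @kneser _ (part A u) (part A v).
- by apply/fset0Pn; exists u; apply: upart.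
- by apply/fset0Pn; exists v; apply: upart.
have SKH : S `<=` KH.
  apply: (period_sub_torsion _ _ _ sS pS).
  - by apply/fset0Pn; exists (u + v); rewrite mem_sumset ?upart.
  - by apply: sumsetS; apply/fsubsetP=> z; rewrite !inE => /andP[].
  move=> _ _ /sumsetP[x [y [xu yv ->]]] /sumsetP[x' [y' [xu' yv' ->]]].
  move: xu yv xu' yv'; rewrite !inE => /andP[_ xu] /andP[_ yv] /andP[_ xu'] /andP[_ yv'].
  rewrite !phiD opprD addrACA (subgroupD sK) //.
    exact: (subgroup_diff sK xu (subgroup_opp sK xu')).
  exact: (subgroup_diff sK yv (subgroup_opp sK yv')).
have layers := leq_card_layers; rewrite -/n in layers.
have akL : (#|` phi @` sumset A KH| <= #|` AK|)%N.
  by rewrite -sumset_torsion_part leq_card_sumset_subgroup.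
have [SE|nS] := eqVneq S KH; last first.
  have S2 := proper_subgroup_card sS torsion_part_subgroup SKH nS.
  apply: (count_small_period n2 aE EA EAn kn K2 abL sM cM (def u uA) (def v vA) sparse _ S2).
  - apply: leq_trans leS; apply: leq_add; exact: leq_card_sumset_subgroup.
  - exact: leq_trans layers akL.
  exact: leq_card_torsion_part.
(* With period [KH], Kneser's bound involves the parts filled up by [KH], so the holes are counted
   for [sumset A KH], which has the same hull as [A]. *)
have defH z : z \in A ->
    (#|` K| + #|` phi @` sumset A KH| <= #|` AK| + #|` sumset (part A z) KH|)%N.
  move=> zA; have zAK : z \in sumset A KH.
    exact: (fsubsetP (sub_sumset_subgroup torsion_part_subgroup _)).
  apply: leq_trans (card_deficit zAK) _; rewrite sumset_torsion_part leq_add2l.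
  apply: leq_trans (leq_imfset_card _ _ _) _; apply: fsubset_leq_card.
  apply/fsubsetP=> y; rewrite !inE => /andP[/sumsetP[x [k [xA kK ->]]] xkz].
  apply: mem_sumset => //; rewrite !inE xA /=.
  move: kK; rewrite torsion_partP => /andP[_ kK].
  by have := subgroupB sK xkz kK; rewrite phiD addrAC addrK.
rewrite SE in leS.
apply: (count_full_period n2 aE EA EAn kn K2 abL sM cM (defH u uA) (defH v vA) leS layers).
apply: fsubset_leq_card.
apply/fsubsetP=> _ /imfsetP[x /= xA ->]; apply: mem_fimage.
exact: (fsubsetP (sub_sumset_subgroup torsion_part_subgroup _)).
Qed.

(** [A'] lies in [K], and the heights occurring over [K] are multiples of the least positive one.
    The witness [d] attains it, and [N] is [psi g] divided by [psi d]. *)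
Lemma wrap_progression z : psi z = 1 -> (#|` AK| < 2 * #|` K|)%N ->
  exists d N, [/\ 0 < psi d,
    forall x, x \in A -> exists2 j, (j <= N)%N & x - d *+ j \in KH &
    (N * #|` KH| <= #|` K|)%N].
Proof.
move=> z1 ltK.
have psiM x i : psi (x *+ i) = psi x * i%:Z by rewrite raddfMn -mulr_natr natz.
have psiz x i : psi (x *~ i) = psi x * i by rewrite raddfMz -mulrzr intz.
have AKle := periodic_card_lt2 sK (periodic_sumset sK A') ltK.
have KAK : K `<=` AK.
  apply/fsubsetP=> k kK; rewrite -(add0r k) mem_sumset // -phi0.
  exact: mem_fimage.
have KE : AK = K by apply/esym/eqP; rewrite eqEfcard KAK.
have AK' x : x \in A -> phi x \in K.
  by move=> xA; rewrite -KE; apply/(fsubsetP (sub_sumset_subgroup sK _))/mem_fimage.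
(* The successor encodes positivity of the height, and searching [h] in the finite [H] makes [p]
   boolean for [ex_minnP]. *)
pose p m := has (fun h => phi (z *+ m.+1 + h) \in K) H.
have pP x m : psi x = m.+1%:Z -> phi x \in K -> p m.
  move=> xm xK; apply/hasP; exists (x - z *+ m.+1); last by rewrite addrC subrK.
  by rewrite HP psiB psiM z1 xm mul1r subrr.
have exp : exists m, p m.
  exists (absz (psi g)).-1; apply: (pP g); last exact: AK'.
  by move: g0; case: (psi g) => // -[].
case: (ex_minnP exp) => m /hasP[h hH hK] minm.
set d := z *+ m.+1 + h in hK; have psid : psi d = m.+1%:Z.
  by move: hH; rewrite HP => /eqP h0; rewrite psiD psiM z1 h0 mul1r addr0.
have dn k : phi (d *+ k) \in K.
  elim: k => [|k IH]; first by rewrite mulr0n raddf0 (subgroup0 sK).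
  by rewrite mulrS phiD (subgroupD sK).
have dK i : phi (d *~ i) \in K.
  by case: i => k; rewrite ?NegzE ?mulrNz ?raddfN ?(subgroupN sK) //; apply: dn.
have divd x : phi x \in K -> psi x = (psi x %/ m.+1%:Z)%Z * m.+1%:Z.
  move=> xK; set q := (_ %/ _)%Z; have E := divz_eq (psi x) m.+1%:Z.
  have r0 := modz_ge0 (psi x) (isT : m.+1%:Z != 0).
  have rm := ltz_pmod (psi x) (isT : 0 < m.+1%:Z).
  rewrite -/q in E; move: (_ %% _)%Z r0 rm E => [[|r]|//] _ rm E; first by rewrite E addr0.
  (* A nonzero remainder [r.+1] would be a positive height over [K] below the least one. *)
  suff /minm : p r by lia.
  apply: (pP (x - d *~ q)); last by rewrite phiB (subgroupB sK).
  by rewrite psiB psiz psid E mulrC addrAC subrr add0r.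
have divA x : x \in A -> exists2 j : nat, psi x = m.+1%:Z * j%:Z & x - d *+ j \in KH.
  move=> xA; have [hx _] := andP (Ah xA); have E := divd x (AK' x xA).
  have : 0 <= (psi x %/ m.+1%:Z)%Z by rewrite divz_ge0.
  case: (_ %/ _)%Z E => // j E _; exists j; first by rewrite E mulrC.
  by rewrite torsion_partP psiB psiM psid E mulrC subrr eqxx phiB (subgroupB sK (AK' x xA) (dn j)).
have [N NE _] := divA g Ag; exists d, N; split; first by rewrite psid.
  move=> x xA; have [j jE xj] := divA x xA; exists j => //.
  have := Ah xA; rewrite NE jE; nia.
(* Only [j < N] is used: [d *+ N] differs from [g] by an element of [KH], so it repeats the layer
   [j = 0]. *)
rewrite -[N in (N * _)%N](@card_imfset_ord _ N val val_inj).
apply: (@leq_cardfs_mul _ _ _ _ _ _ (fun j k => phi (d *+ j + k))) => [j k _|].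
  by rewrite torsion_partP phiD => /andP[_ kK]; rewrite (subgroupD sK (dn _) kK).
move=> _ k _ k' /imfsetP[/= j _ ->] + /imfsetP[/= j' _ ->].
rewrite !torsion_partP => /andP[/eqP k0 _] /andP[/eqP k0' _].
move=> /phi_eq[i []]; rewrite !psiD !psiM k0 k0' psid NE !addr0 => Eq Ei.
have [ltj ltj'] := (ltn_ord j, ltn_ord j').
have {}Ei : (j : nat)%:Z = (j' : nat)%:Z + i * N%:Z.
  by apply: (mulfI (isT : m.+1%:Z != 0)); rewrite Ei mulrDr mulrCA.
have i0 : i = 0.
  by move: ltj ltj' Ei; move: (nat_of_ord j) (nat_of_ord j') => a b; clear; nia.
move: Ei; rewrite i0 mul0r addr0 => -[jj].
by move: Eq; rewrite i0 jj mulr0z addr0 => /addrI.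
Qed.

End Wrap.

(** * Small doubling *)

Lemma fset_argmin (T : choiceType) (f : T -> int) (A : {fset T}) :
  A != fset0 -> exists2 x, x \in A & forall y, y \in A -> f x <= f y.
Proof.
case/fset0Pn=> x xA; have [m] := ubnP #|` [fset y in A | f y < f x]|.
elim: m x xA => // m IH x xA ltm.
have [e|/fset0Pn[z]] := eqVneq [fset y in A | f y < f x] fset0.
  exists x => // y yA; rewrite leNgt; apply/negP=> lt.
  by have := in_fset0 y; rewrite -e !inE yA lt.
rewrite !inE => /andP[zA zx]; apply: (IH z zA); rewrite ltnS in ltm; apply: leq_trans ltm.
apply: fproper_ltn_card; rewrite fproperE; apply/andP; split.
  by apply/fsubsetP=> y; rewrite !inE => /andP[-> /lt_trans-> //].
by apply/fsubsetPn; exists z; rewrite !inE zA ?zx // ltxx.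
Qed.

Lemma leq_card_sumset (G : zmodType) (X Y : {fset G}) :
  (#|` sumset X Y| <= #|` X| * #|` Y|)%N.
Proof.
rewrite -cardfsM; pose f (u : G * G) := u.1 + u.2.
apply: (@leq_trans #|` f @` (X `*` Y)|); last exact: leq_imfset_card.
apply: fsubset_leq_card; apply/fsubsetP=> _ /sumsetP[x [y [xX yY ->]]].
by apply/imfsetP; exists (x, y); rewrite //= in_fsetM /= xX.
Qed.

Section Strip.
Variables (G : zmodType) (psi : {additive G -> int}) (H : {fset G}) (z : G).
Hypotheses (z1 : psi z = 1) (HP : forall x, (x \in H) = (psi x == 0)).

Lemma small_doubling_based (A : {fset G}) (g : G) :
  0 \in A -> g \in A -> 0 < psi g -> (forall x, x \in A -> 0 <= psi x <= psi g) ->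
  (1 < #|` psi @` A|)%N ->
  (#|` psi @` A| * #|` sumset A A| + 3 * #|` A| < 3 * (#|` psi @` A| * #|` A|))%N ->
  exists d N K, [/\ subgroup K, K `<=` H, 0 < psi d,
    forall x, x \in A -> exists2 j, (j <= N)%N & x - d *+ j \in K &
    (N * #|` K| + #|` A| <= #|` sumset A A|)%N].
Proof.
move=> A0 Ag g0 Ah n2; rewrite ltnNge => small.
have [Q [phi phiP]] := cyclic_quotient (lt0r_neq0 g0).
have A'0 : phi @` A != fset0 by apply/fset0Pn; exists (phi 0); apply: mem_fimage.
have [K [sK pK]] := kneser A'0 A'0; rewrite addnn -mul2n => kn.
case: (leqP (2 * #|` K|) #|` sumset (phi @` A) K|) => [big|lt].
  by case/negP: small; apply: (count_doubling A0 Ag g0 Ah phiP HP sK pK kn).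
have [d [N [d0 dA dN]]] := wrap_progression A0 Ag g0 Ah phiP HP sK pK kn z1 lt.
exists d, N, (torsion_part phi H K); split=> //.
- exact: (torsion_part_subgroup phi HP sK).
- by apply/fsubsetP=> x; rewrite !inE => /andP[].
(* The wrapped sumset contains a coset of [K], which pays for the [N] layers, and [E + A] pays for
   [A]. *)
apply: leq_trans (leq_card_sumset_doubled A0 Ag g0 phiP); apply: leq_add.
  apply: leq_trans dN _; rewrite -(card_coset (phi 0 + phi 0)).
  apply: fsubset_leq_card; apply: periodic_coset_sub => //.
  by apply: mem_sumset; apply: mem_fimage.
by apply: leq_card_sumsetr; apply: (doubled_ends0 A0 Ag).
Qed.

Lemma small_doubling (A : {fset G}) :
  (#|` psi @` A| * #|` sumset A A| + 3 * #|` A| < 3 * (#|` psi @` A| * #|` A|))%N ->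
  exists c d N K, [/\ subgroup K, K `<=` H, 0 < psi d,
    forall x, x \in A -> exists2 j, (j <= N)%N & x - (c + d *+ j) \in K &
    (N * #|` K| + #|` A| <= #|` sumset A A|)%N].
Proof.
have psiD x y : psi (x + y) = psi x + psi y by exact: raddfD.
have psiB x y : psi (x - y) = psi x - psi y by exact: raddfB.
move=> small; have n2 : (1 < #|` psi @` A|)%N.
  by move: small; case: #|` psi @` A| => [|[]] // ; rewrite ?mul0n ?mul1n; lia.
have Ane : A != fset0.
  by apply: contraTneq n2 => ->; rewrite imfset0 cardfs0.
have [a aA amin] := fset_argmin psi Ane.
have [b bA bmax] := fset_argmin (fun x => - psi x) Ane.
(* Moving a lowest element to [0] puts all heights between 0 and that of [b - a]. *)
set B := coset (- a) A.
have BP x : (x \in B) = (x + a \in A) by rewrite mem_coset opprK.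
have cB : #|` B| = #|` A| := card_coset _ _.
have cBB : #|` sumset B B| = #|` sumset A A|.
  by rewrite sumset_cosetr sumsetC sumset_cosetr !card_coset.
have psiBE : psi @` B = coset (- psi a) (psi @` A).
  apply/fsetP=> v; rewrite mem_coset opprK; apply/imfsetP/imfsetP=> /= -[x].
    by rewrite BP => xA ->; exists (x + a); rewrite ?psiD.
  by move=> xA E; exists (x - a); rewrite ?BP ?subrK // psiB -E addrK.
have cn : #|` psi @` B| = #|` psi @` A| by rewrite psiBE card_coset.
have [||||||d [N [K [sK KH d0 dB le]]]] := @small_doubling_based B (b - a).
- by rewrite BP add0r.
- by rewrite BP subrK.
- rewrite psiB subr_gt0 lt_neqAle amin // andbT; apply: contraTneq n2 => ab.
  rewrite -leqNgt -(cardfs1 (psi a)); apply: fsubset_leq_card.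
  apply/fsubsetP=> _ /imfsetP[x /= xA ->]; rewrite in_fset1 eq_le amin //.
  by rewrite ab -lerN2 bmax.
- move=> x; rewrite BP => xA; have := amin _ xA; have := bmax _ xA.
  by rewrite psiB psiD; lia.
- by rewrite cn.
- by rewrite cn cBB cB.
exists a, d, N, K; split=> //; last by rewrite -cB -cBB.
move=> x xA; have [|j jN xj] := dB (x - a); first by rewrite BP subrK.
by exists j => //; rewrite opprD addrA.
Qed.

End Strip.

(** * From the direct sum to heights, and back to [P] and [K] *)

Lemma height_function (G : zmodType) (Z : {pred G}) (H : {fset G}) (p : G -> G) :
  infinite_cyclic Z -> zmod_closed (mem H) -> direct_sum Z (mem H) ->
  projection_along Z (mem H) p ->
  exists z (psi : {additive G -> int}), [/\ psi z = 1,
    forall x, (x \in H) = (psi x == 0), injective (fun m : int => z *~ m) &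
    forall x, p x = z *~ psi x].
Proof.
move=> [z [injz ZP]] sH [_ ZH0] hp.
have uniq_height m : z *~ m \in H -> m = 0.
  move=> mH; apply: injz; rewrite mulr0z; apply: ZH0 => //.
  by apply/ZP; exists m.
have ex x : exists m, p x == z *~ m.
  by have [/ZP[m ->] _] := hp x; exists m.
pose psi x : int := xchoose (ex x).
have pE x : p x = z *~ psi x by apply/eqP/(xchooseP (ex x)).
have psiH x : x - z *~ psi x \in H by rewrite -pE; case: (hp x).
(* Heights are unique because the sum is direct; additivity, the value at [z] and the description of
   [H] all reduce to this. *)
have psi_eq x m : x - z *~ m \in H -> psi x = m.
  move=> xm; apply/eqP; rewrite -subr_eq0; apply/eqP/uniq_height.
  have := subgroupB sH xm (psiH x).
  by rewrite opprB addrC addrA subrK -mulrzBr.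
have psi_zmod : zmod_morphism psi.
  move=> x y; apply: psi_eq; rewrite mulrzBr opprD addrACA -opprD.
  exact: (subgroupB sH (psiH x) (psiH y)).
pose f : {additive G -> int} := HB.pack psi (GRing.isZmodMorphism.Build G int psi psi_zmod).
exists z, f; split=> // [|x].
  by apply: psi_eq; rewrite mulr1z subrr (subgroup0 sH).
apply/idP/eqP=> [xH|x0]; first by apply: psi_eq; rewrite mulr0z subr0.
by have := psiH x; rewrite -[psi x]/(f x) x0 mulr0z subr0.
Qed.

Theorem theorem2 (G : zmodType) (Z : {pred G}) (H : {fset G})
    (hZ : infinite_cyclic Z) (hH : zmod_closed (mem H))
    (hG : direct_sum Z (mem H))
    (p : G -> G) (hp : projection_along Z (mem H) p)
    (A : {fset G}) (n : nat) (hn : n = #|` [fset p x | x in A]|)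
    (tau : rat) (htau : tau = #|` sumset A A|%:R / #|` A|%:R)
    (hA : #|` sumset A A|%:R < 3 * (1 - 1 / n%:R) * #|` A|%:R :> rat) :
  exists (P K : {fset G}),
    [/\ arith_prog P,
        (3 <= #|` P|)%N /\ (#|` P|%:R <= (tau - 1) * n%:R + 1 :> rat),
        zmod_closed (mem K) /\ K `<=` H,
        #|` sumset P K| = (#|` P| * #|` K|)%N /\ A `<=` sumset P K &
        (#|` P|%:R - 1) * #|` K|%:R <= #|` sumset A A|%:R - #|` A|%:R :> rat].
Proof.
have [z [psi [z1 HP injz pE]]] := height_function hZ hH hG hp.
have psiD x y : psi (x + y) = psi x + psi y by exact: raddfD.
have psiM x i : psi (x *+ i) = psi x * i%:Z by rewrite raddfMn -mulr_natr natz.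
have {}hn : n = #|` psi @` A|.
  rewrite hn -[RHS](card_coset 0); have -> : [fset p x | x in A] = (fun m => z *~ m) @` (psi @` A).
    apply/fsetP=> y; apply/imfsetP/imfsetP=> /= -[x xA ->].
      by exists (psi x); rewrite ?mem_fimage.
    by case/imfsetP: xA => u /= uA ->; exists u.
  by rewrite card_coset card_imfset.
set M := #|` sumset A A| in htau hA *; set a := #|` A| in htau hA *.
(* The inverse of 0 is 0 in [rat], so [n = 0] is excluded first: then [A] is empty and the right
   side of [hA] vanishes. *)
have n0 : (0 < n)%N.
  rewrite lt0n; apply: contraTneq hA => n0; rewrite -leNgt.
  have -> : a = 0%N.
    apply/eqP; rewrite cardfs_eq0; apply/negPn/negP=> /fset0Pn[x xA].
    by move/eqP: hn; rewrite n0 eq_sym cardfs_eq0 => /eqP e; have := mem_fimage psi xA; rewrite e.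
  by rewrite mulr0 ler0n.
have small : (n * M + 3 * a < 3 * (n * a))%N.
  have nR : 0 < n%:R :> rat by rewrite ltr0n.
  rewrite -(ltr_nat rat) !natrD !natrM.
  have := ltr_pM2l nR M%:R (3 * (1 - 1 / n%:R) * a%:R); rewrite hA.
  have -> : n%:R * (3 * (1 - 1 / n%:R) * a%:R) = 3 * (n%:R * a%:R) - 3 * a%:R :> rat.
    by field; rewrite lt0r_neq0.
  lra.
rewrite /M /a hn in small; have [c [d [N [K [sK KH d0 AP le]]]]] := small_doubling z1 HP small.
rewrite -hn -/M -/a in small le.
pose P := [fset c + d *+ val j | j in 'I_N.+1].
have Kpsi k : k \in K -> psi k = 0 by move=> kK; apply/eqP; rewrite -HP (fsubsetP KH).
have psi_inj i j : psi (c + d *+ i) = psi (c + d *+ j) -> i = j.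
  by rewrite !psiD !psiM => /addrI/(mulfI (lt0r_neq0 d0))[].
have cP : #|` P| = N.+1.
  by apply: card_imfset_ord => i j E; apply/val_inj/psi_inj; rewrite E.
have memP j : (j <= N)%N -> c + d *+ j \in P.
  by move=> jN; apply/imfsetP; exists (inord j); rewrite //= inordK.
have psiP : {in P &, injective psi}.
  by move=> _ _ /imfsetP[i /= _ ->] /imfsetP[j /= _ ->] /psi_inj ->.
have cPK : #|` sumset P K| = (#|` P| * #|` K|)%N.
  apply/eqP; rewrite eqn_leq leq_card_sumset; apply: (leq_cardfs_mul (@mem_sumset _ P K)).
  move=> x k x' k' xP kK x'P k'K E; have := congr1 psi E.
  rewrite !psiD (Kpsi _ kK) (Kpsi _ k'K) !addr0 => /psiP Ex; split; first exact: Ex.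
  by move: E; rewrite Ex // => /addrI.
have APK : A `<=` sumset P K.
  apply/fsubsetP=> x xA; have [j jN xj] := AP x xA.
  by rewrite -(subrK (c + d *+ j) x) addrC mem_sumset ?memP.
have nP : (n <= N.+1)%N.
  rewrite -cP hn; apply: (@leq_trans #|` psi @` P|); last exact: leq_imfset_card.
  apply: fsubset_leq_card; apply/fsubsetP=> _ /imfsetP[x /= xA ->].
  have /sumsetP[y [k [yP kK ->]]] := fsubsetP APK x xA.
  by rewrite psiD (Kpsi _ kK) addr0 mem_fimage.
(* The points of [P] at heights occurring in [A] already cover [A] modulo [K], and there are at most
   [n] of them. *)
have anK : (a <= n * #|` K|)%N.
  set P' := [fset y in P | psi y \in psi @` A].
  have AP' : A `<=` sumset P' K.
    apply/fsubsetP=> x xA; have /sumsetP[y [k [yP kK xE]]] := fsubsetP APK x xA.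
    rewrite xE mem_sumset // !inE yP /=; have := mem_fimage psi xA.
    by rewrite xE psiD (Kpsi _ kK) addr0.
  apply: leq_trans (fsubset_leq_card AP') (leq_trans (leq_card_sumset _ _) _).
  rewrite leq_mul2r hn; apply/orP; right; apply: (@leq_cardfs_in_inj _ _ psi) => [x y|x].
    by rewrite !inE => /andP[xP _] /andP[yP _]; apply: psiP.
  by rewrite !inE => /andP[].
have a0 : (0 < a)%N by case: (a) small => //; rewrite !muln0 addn0.
(* [N <= 1] forces [n <= 2]. The value 1 contradicts [small]; for 2, [anK] and [le] give
   [3 * a <= 2 * M], against [small]. *)
have N2 : (1 < N)%N.
  rewrite ltnNge; apply/negP=> N1.
  have n12 : n = 1%N \/ n = 2%N by lia.
  case: n12 => n12; rewrite n12 in small anK nP; first lia.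
  have NE : N = 1%N by lia.
  by rewrite NE in le; lia.
have leR : N%:R * #|` K|%:R + a%:R <= M%:R :> rat by rewrite -natrM -natrD ler_nat.
exists P, K; split.
- by exists c, d, N.
- split; first by rewrite cP.
  (* Combined with [leR] multiplied by [n], this gives [N * a <= n * (M - a)]; division by [a] is
     the bound with [tau]. *)
  have NaR : N%:R * a%:R <= N%:R * (n%:R * #|` K|%:R) :> rat.
    by rewrite -!natrM ler_nat leq_mul2l anK orbT.
  have aR : 0 < a%:R :> rat by rewrite ltr0n.
  rewrite cP -(natr1 N) lerD2r htau -(ler_pM2r aR) mulrAC mulrBl divfK ?lt0r_neq0 // mul1r.
  apply: le_trans NaR _; rewrite mulrCA mulrC ler_wpM2r ?ler0n //; lra.
- by split.
- by split.
by rewrite cP -natr1 addrK; lra.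
Qed.
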